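(* Let $p\geq 7$ be a prime number. Consider the left braces, up to isomorphism, with additive group $\mathbf{Z}_p\times\mathbf{Z}_6\times\mathbf{Z}_2$ and multiplicative group a semidirect product $\mathbf{Z}_p\rtimes\mathbf{Z}_{12}$. 1) If $p\equiv 11\pmod{12}$ there are 2 such braces. One of them is a direct product and the second one has a kernel of order 6. 2) If $p\equiv 5\pmod{12}$ there are 3 such braces. One of them is a direct product, one has a kernel of order 6, and the third one has a kernel of order 3. 3) If $p\equiv 7\pmod{12}$ there are 4 such braces. One of them is a direct product, one has a kernel of order 6, and the other two have kernels of orders 2 and 4, respectively. 4) If $p\equiv 1\pmod{12}$ there are 6 such braces. One of them is a direct product and the other five have kernels of orders 6, 4, 3, 2, 1, respectively.
   Context: A left brace is a set $B$ with operations $+,\cdot$ such that $(B,+)$ is an abelian group (additive group), $(B,\cdot)$ is a group (multiplicative group), and $a(b+c)=ab-a+ac$ for all $a,b,c\in B$. Isomorphisms are bijections preserving both operations. $\mathbf{Z}_m=\mathbf{Z}/m\mathbf{Z}$. Given a left brace $B'$ of size 12 with multiplicative group $F$ and a group morphism $\tau:F\to\mathrm{Aut}(\mathbf{Z}_p)\simeq\mathbf{Z}_p^*$, the semidirect product of the trivial brace $\mathbf{Z}_p$ (with $a\cdot b=a+b$) and $B'$ via $\tau$ is $\mathbf{Z}_p\times B'$ with componentwise addition and $(a,b)\cdot(a',b')=(a+\tau(b)a',bb')$; it is the direct product of braces when $\tau$ is trivial. For $p\geq 7$ every left brace of size $12p$ is isomorphic to one of this form. The kernel of the brace means $\ker\tau\subseteq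 F$. ''Multiplicative group $\mathbf{Z}_p\rtimes F$'' means isomorphic to $\mathbf{Z}_p\rtimes_\tau F$ for some $\tau$, possibly trivial. *)

(* Defs.v *)
From HB Require Import structures.
From mathcomp Require Import all_boot all_order all_algebra all_fingroup cyclic.

Set Implicit Arguments.
Unset Strict Implicit.
Unset Printing Implicit Defensive.

Import GRing.Theory.

Local Open Scope ring_scope.

(* The second group law of a brace has its own operations: reusing baseGroupType
   on the carrier would clash with the group structure that MathComp infers for
   every finZmodType from its addition. *)
HB.mixin Record Zmodule_isLeftBrace B of GRing.Zmodule B := {
  bone : B;
  binv : B -> B;
  bmul : B -> B -> B;
  bmulA : associative bmul;
  bmul1b : left_id bone bmul;
  bmulVb : left_inverse bone binv bmul;
  bmulDr : forall a b c : B, bmul a (b + c) = bmul a b - a + bmul a c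
}.

#[short(type="leftBraceType")]
HB.structure Definition LeftBrace :=
  {B of Zmodule_isLeftBrace B & GRing.Zmodule B}.

#[short(type="finLeftBraceType")]
HB.structure Definition FinLeftBrace :=
  {B of LeftBrace B & FinRing.Zmodule B}.

Definition mul_group (B : finLeftBraceType) : Type := B.

HB.instance Definition _ (B : finLeftBraceType) := Finite.on (mul_group B).
HB.instance Definition _ (B : finLeftBraceType) :=
  Finite_isGroup.Build (mul_group B) (@bmulA B) (@bmul1b B) (@bmulVb B).

Definition brace_iso (B1 B2 : leftBraceType) : Prop :=
  exists f : B1 -> B2,
    [/\ bijective f, {morph f : a b / a + b} & {morph f : a b / bmul a b}].

(* Aut(Z_p) is identified with the group of units of Z_p, acting by
   multiplication. *)
Definition brace_sdprod (p : nat) (B : finLeftBraceType)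
  (tau : {morphism [set: mul_group B] >-> {unit 'Z_p}}) : Type := ('Z_p * B)%type.

Section BraceSdprod.

Variables (p : nat) (B : finLeftBraceType).
Variable tau : {morphism [set: mul_group B] >-> {unit 'Z_p}}.

Local Notation sdT := (brace_sdprod tau).

HB.instance Definition _ := GRing.Zmodule.copy sdT ('Z_p * B)%type.
HB.instance Definition _ := Finite.copy sdT ('Z_p * B)%type.

Definition sd_one : sdT := (0, bone).
Definition sd_inv (u : sdT) : sdT :=
  (- (val (tau (binv u.2)) * u.1), binv u.2).
Definition sd_mul (u v : sdT) : sdT :=
  (u.1 + val (tau u.2) * v.1, bmul u.2 v.2).

Let tauM (b c : B) : val (tau (bmul b c)) = val (tau b) * val (tau c).
Proof. by rewrite (morphM tau (x := b : mul_group B) (y := c)) ?inE. Qed.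

Let tau1 : val (tau bone) = 1.
Proof. by rewrite (morph1 tau). Qed.

Fact sd_mulA : associative sd_mul.
Proof.
by move=> u v w; rewrite /sd_mul /= tauM bmulA mulrDr mulrA addrA.
Qed.

Fact sd_mul1b : left_id sd_one sd_mul.
Proof. by case=> a b; rewrite /sd_mul /= tau1 mul1r add0r bmul1b. Qed.

Fact sd_mulVb : left_inverse sd_one sd_inv sd_mul.
Proof. by case=> a b; rewrite /sd_mul /= addNr bmulVb. Qed.

Fact sd_mulDr (u v w : sdT) : sd_mul u (v + w) = sd_mul u v - u + sd_mul u w.
Proof.
case: u v w => [a b] [c d] [e f]; rewrite /sd_mul; congr pair => /=.
  by rewrite mulrDr [a + _ * c]addrC addrK addrCA.
exact: bmulDr.
Qed.

HB.instance Definition _ :=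
  Zmodule_isLeftBrace.Build sdT sd_mulA sd_mul1b sd_mulVb sd_mulDr.

End BraceSdprod.

Definition is_direct_product (p : nat) (B : finLeftBraceType) : Prop :=
  exists (B' : finLeftBraceType)
         (tau : {morphism [set: mul_group B'] >-> {unit 'Z_p}}),
    [/\ #|B'| = 12%N, (forall b, tau b = 1%g) & brace_iso B (brace_sdprod tau)].

Definition has_kernel_of_order (p : nat) (B : finLeftBraceType) (k : nat) : Prop :=
  exists (B' : finLeftBraceType)
         (tau : {morphism [set: mul_group B'] >-> {unit 'Z_p}}),
    [/\ #|B'| = 12%N, #|('ker tau)%g| = k & brace_iso B (brace_sdprod tau)].

Fact bmulb0 (B : leftBraceType) (b : B) : bmul b 0 = b.
Proof.
have /eqP := bmulDr b 0 0.
by rewrite addr0 -addrA -{1}(addr0 (bmul b 0)) (inj_eq (addrI _)) addrC eq_sym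
           subr_eq0 => /eqP.
Qed.

Fact brace_sdprod_ker_card (p : nat) (B1 B2 : finLeftBraceType)
    (tau1 : {morphism [set: mul_group B1] >-> {unit 'Z_p}})
    (tau2 : {morphism [set: mul_group B2] >-> {unit 'Z_p}}) :
    (1 < p)%N -> coprime p #|B2| ->
    brace_iso (brace_sdprod tau1) (brace_sdprod tau2) ->
  #|('ker tau1)%g| = #|('ker tau2)%g|.
Proof.
move=> p_gt1 copB2 [f [[f' fK f'K] fD fM]].
have f0 : f 0 = 0 by apply: (@addrI _ (f 0)); rewrite -fD !addr0.
have fMn u n : f (u *+ n) = f u *+ n.
  by elim: n => [|n IHn]; rewrite ?mulr0n ?mulrS ?fD ?IHn.
have fB u v : f (u - v) = f u - f v.
  by apply: (@addIr _ (f v)); rewrite -fD !subrK.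
have pairMn (T1 T2 : zmodType) (a : T1) (b : T2) n :
    (a, b) *+ n = (a *+ n, b *+ n).
  by elim: n => [|n IHn]; rewrite ?mulr0n // !mulrS IHn.
pose i1 a : brace_sdprod tau1 := (a, 0); pose g a := (f (i1 a)).1.
have fi1 a : f (i1 a) = (g a, 0).
  rewrite /g; have: (f (i1 a)) *+ p = 0.
    by rewrite -fMn /i1 pairMn mul0rn -mulr_natr pchar_Zp ?mulr0.
  case: (f (i1 a)) => x y /=; rewrite pairMn => -[_ yp].
  congr pair; have: (#[y : (B2 : finZmodType)]%g %| gcdn p #|B2|)%N.
    rewrite dvdn_gcd order_dvdn FinRing.zmodXgE yp eqxx -cardsT.
    by apply: (@order_dvdG _ [set: (B2 : finZmodType)]%G); rewrite inE.
  by rewrite (eqP copB2) dvdn1 order_eq1 => /eqP.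
have g_inj : injective g.
  move=> a c gac; have: f (i1 a) = f (i1 c) by rewrite !fi1 gac.
  by move/(can_inj fK) => -[].
have lamE (B : finLeftBraceType)
    (tau : {morphism [set: mul_group B] >-> {unit 'Z_p}})
    (u : brace_sdprod tau) (a : 'Z_p) :
    bmul u ((a, 0) : brace_sdprod tau) - u = (val (tau u.2) * a, 0).
  case: u => x b; congr pair => /=; first by rewrite addrC addKr.
  by rewrite bmulb0 subrr.
have fker u : (tau1 u.2 == 1%g) = (tau2 (f u).2 == 1%g).
  have eq_tau a : g (val (tau1 u.2) * a) = val (tau2 (f u).2) * g a.
    have := congr1 f (lamE _ _ u a).
    by rewrite fB fM -/(i1 a) -/(i1 (_ * a)) !fi1 lamE => -[].
  apply/eqP/eqP => [tau_u | tau_fu].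
    have [h _ hK] := injF_bij g_inj.
    apply: val_inj; have := eq_tau (h 1).
    by rewrite tau_u mul1r hK mulr1.
  apply: val_inj; apply: g_inj.
  by have := eq_tau 1; rewrite tau_fu mul1r mulr1.
pose K (B : finLeftBraceType)
  (tau : {morphism [set: mul_group B] >-> {unit 'Z_p}}) :=
  [set u : brace_sdprod tau | tau u.2 == 1%g].
have cardK B (tau : {morphism [set: mul_group B] >-> {unit 'Z_p}}) :
    #|K B tau| = (p * #|('ker tau)%g|)%N.
  have -> : K B tau = setX [set: 'Z_p] ('ker tau)%g.
    by apply/setP=> -[a b]; rewrite !inE.
  by rewrite cardsX cardsT card_ord Zp_cast.
apply/eqP; rewrite -(eqn_pmul2l (ltnW p_gt1)) -!cardK; apply/eqP.
rewrite -(card_imset _ (can_inj fK)); congr #|pred_of_set _|.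
apply/setP=> v; rewrite inE -{2}(f'K v) -fker.
by rewrite -{1}(f'K v) (mem_imset _ _ (can_inj fK)) inE.
Qed.

Fact brace_iso_sym (B1 B2 : leftBraceType) : brace_iso B1 B2 -> brace_iso B2 B1.
Proof.
move=> [f [[g fK gK] fD fM]]; exists g; split; first by exists f.
  by move=> a b; apply: (can_inj fK); rewrite fD !gK.
by move=> a b; apply: (can_inj fK); rewrite fM !gK.
Qed.

Fact brace_iso_trans (B1 B2 B3 : leftBraceType) :
  brace_iso B1 B2 -> brace_iso B2 B3 -> brace_iso B1 B3.
Proof.
move=> [f [f_bij fD fM]] [g [g_bij gD gM]]; exists (g \o f).
by split=> [|a b|a b]; rewrite /= ?fD ?gD ?fM ?gM //; apply: bij_comp.
Qed.

(* The order of the kernel does not depend on the chosen presentation. *)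
Fact has_kernel_of_order_inj (p : nat) (B : finLeftBraceType) (k1 k2 : nat) :
  (1 < p)%N -> coprime p 12 ->
  has_kernel_of_order p B k1 -> has_kernel_of_order p B k2 -> k1 = k2.
Proof.
move=> p_gt1 cop [B1 [tau1 [_ <- iso1]]] [B2 [tau2 [cardB2 <- iso2]]].
apply: brace_sdprod_ker_card; rewrite ?cardB2 //.
exact: brace_iso_trans (brace_iso_sym iso1) iso2.
Qed.

Definition has_groups_Zp62_ZpZ12 (p : nat) (B : finLeftBraceType) : Prop :=
  [set: (B : finZmodType)] \isog [set: 'Z_p * 'Z_6 * 'Z_2]
  /\ exists to : groupAction [set: 'Z_12] [set: 'Z_p],
       [set: mul_group B] \isog [set: sdprod_by to].

Definition iso_representatives (P : finLeftBraceType -> Prop) (n : nat)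
    (Bs : 'I_n -> finLeftBraceType) : Prop :=
  [/\ forall i, P (Bs i),
      forall i j, brace_iso (Bs i) (Bs j) -> i = j
    & forall B, P B -> exists i, brace_iso B (Bs i)].

(* Main.v *)
From HB Require Import structures.
Require Import Defs.
From mathcomp Require Import all_boot all_order all_algebra all_fingroup.
From mathcomp Require Import cyclic ring.

(** Let B be a brace as in the theorem. For every a in B the map
    lam a : b |-> a b - a is an automorphism of the additive group, and
    lam (a b) = lam a o lam b. Hence each torsion subgroup of (B, +) is
    stable under all the maps lam x, and therefore is a subgroup of the
    multiplicative group too. As an additive group B = T_p + T_12, where T_n is
    the n-torsion.

    The projection psi of the multiplicative group Z_p ><| Z_12 onto Z_12 has a
    kernel of exponent p, so it restricts to an isomorphism of T_12 with Z_12;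
    let gam be the inverse isomorphism. An element x of T_p acts trivially
    through lam: on T_p because a group of order p acting on p - 1 points has no
    nontrivial orbit ([lam_fix]), on T_12 because psi kills T_p. So
    x y = x + y for x in T_p, and B is the semidirect product of T_p and T_12,
    with gam z acting on T_p as the multiplication by t ^ z, where t is a unit of
    Z_p with t ^ 12 = 1.

    The brace T_12 is determined by its two groups: T_3 is trivial as a brace,
    since a group of order 3 acts trivially on 2 points; T_2 is a Klein group under
    addition, and every bijection of Klein groups that fixes 0 is additive; and
    T_2, T_3 add without interaction because T_12 is multiplicatively abelian.
    Concretely, T_12 is Z_3 x Z_2 x Z_2 with
    (u, x, y) (u', x', y') = (u + u', x + x', y + y' + x x') ([brace12]), and its
    discrete logarithm is [dlog].

    Thus B is the model brace [sdprod12] attached to t, for t the image of the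
    chosen generator gam 1 of Z_12. Another generator gam k replaces t by t ^ k
    with k prime to 12, and these powers are all the elements that have the
    order of t ([same_order_expg]). So the classes correspond to the orders d of
    the elements t with t ^ 12 = 1, that is, to the divisors of gcd (12, p - 1);
    the kernel has order 12 / d, which also separates the classes
    ([classification]). The four cases of the theorem list these divisors. *)

Set Implicit Arguments.
Unset Strict Implicit.
Unset Printing Implicit Defensive.

Import GRing.Theory.
Local Open Scope ring_scope.

(** * Elementary facts on groups *)

Lemma additive0 (U V : zmodType) (f : U -> V) :
  {morph f : x y / x + y} -> f 0 = 0.
Proof. by move=> fD; apply: (@addrI _ (f 0)); rewrite -fD !addr0. Qed.

Lemma additiveMn (U V : zmodType) (f : U -> V) :
  {morph f : x y / x + y} -> forall x n, f (x *+ n) = f x *+ n.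
Proof.
move=> fD x; elim=> [|n IHn]; first by rewrite !mulr0n additive0.
by rewrite !mulrS fD IHn.
Qed.

Lemma multiplicative1 (aT rT : finGroupType) (f : aT -> rT) :
  {morph f : x y / (x * y)%g} -> f 1%g = 1%g.
Proof. by move=> fM; apply: (@mulgI _ (f 1%g)); rewrite -fM !mulg1. Qed.

Lemma multiplicativeX (aT rT : finGroupType) (f : aT -> rT) :
  {morph f : x y / (x * y)%g} -> forall x n, f (x ^+ n)%g = (f x ^+ n)%g.
Proof.
move=> fM x; elim=> [|n IHn]; first by rewrite !expg0 multiplicative1.
by rewrite !expgS fM IHn.
Qed.

Lemma pairMn (U V : zmodType) (u : U) (v : V) n :
  (u, v) *+ n = (u *+ n, v *+ n).
Proof. by elim: n => [|n IHn]; rewrite ?mulr0n // !mulrS IHn. Qed.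

Lemma coprime_torsion (V : zmodType) (v : V) (m n : nat) :
  (0 < m)%N -> coprime m n -> v *+ m = 0 -> v *+ n = 0 -> v = 0.
Proof.
move=> m_gt0 co_mn vm vn; have [km kn def_km _] := egcdnP n m_gt0.
have := congr1 (fun k => v *+ k) def_km.
by rewrite (eqP co_mn) mulrnDr !(mulnC _ m, mulnC kn n) !mulrnA vm vn !mul0rn
           add0r.
Qed.

Lemma coprime_expg_eq1 (gT : finGroupType) (x : gT) (m n : nat) :
  (coprime m n -> x ^+ m = 1 -> x ^+ n = 1 -> x = 1)%g.
Proof.
move=> co_mn /eqP; rewrite -order_dvdn => xm /eqP; rewrite -order_dvdn => xn.
by apply/eqP; rewrite -order_eq1 -dvdn1 -(eqP co_mn) dvdn_gcd xm.
Qed.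

Lemma expg_Zp12D (gT : finGroupType) (t : gT) (a b : 'Z_12) :
  (t ^+ 12 = 1 -> t ^+ (a + b)%R = t ^+ a * t ^+ b)%g.
Proof. by move=> t12; rewrite -expgD; apply: expg_mod. Qed.

Lemma isog_setT (aT rT : finGroupType) (f : aT -> rT) :
    {morph f : x y / (x * y)%g} -> injective f -> (#|rT| <= #|aT|)%N ->
  [set: aT] \isog [set: rT].
Proof.
move=> fM f_inj card_le.
have fMT : {in [set: aT] &, {morph f : x y / (x * y)%g}} by move=> x y _ _.
apply/isogP; exists (Morphism fMT); first by apply/injmP=> x y _ _ /f_inj.
apply/eqP; rewrite eqEcard subsetT morphimEdom card_imset //.
by rewrite !cardsT.
Qed.

Lemma isog_setT_bij (aT rT : finGroupType) :
    [set: aT] \isog [set: rT] ->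
  exists2 f : aT -> rT, bijective f & {morph f : x y / (x * y)%g}.
Proof.
move=> isoT; have /isogP[f f_inj _] := isoT.
exists f; last by move=> x y; rewrite morphM ?inE.
apply: inj_card_bij => [x y|]; first by apply: (injmP f_inj); rewrite inE.
by rewrite -!cardsT (card_isog isoT).
Qed.

(** The sum of two distinct nonzero elements of a Klein group is the third one,
    so the addition can be read off from the neutral element. *)
Lemma klein_additive (V : zmodType) (f : 'Z_2 * 'Z_2 -> V) :
    injective f -> f 0 = 0 -> (forall v, f v + f v = 0) ->
    (forall v w, exists u, f v + f w = f u) ->
  {morph f : v w / v + w}.
Proof.
move=> f_inj f0 f2 f_closed v w.
have w2 : w + w = 0.
  by case: w => [[[|[|//]] ?] [[|[|//]] ?]]; congr (_, _); apply: val_inj.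
have [-> | v_neq0] := eqVneq v 0; first by rewrite f0 !add0r.
have [-> | w_neq0] := eqVneq w 0; first by rewrite f0 !addr0.
have [-> | v_neq_w] := eqVneq v w; first by rewrite f2 w2 f0.
have [u fvw] := f_closed v w; rewrite fvw; congr f.
have u_neq0 : u != 0.
  apply: contraNneq v_neq_w => u0; apply/eqP/f_inj.
  by apply: (@addIr _ (f w)); rewrite fvw u0 f0 f2.
have u_neq_v : u != v.
  apply: contraNneq w_neq0 => uv; apply/eqP/f_inj.
  by apply: (@addrI _ (f v)); rewrite fvw uv f0 addr0.
have u_neq_w : u != w.
  apply: contraNneq v_neq0 => uw; apply/eqP/f_inj.
  by apply: (@addIr _ (f w)); rewrite fvw uw f0 add0r.
move: v_neq0 w_neq0 v_neq_w u_neq0 u_neq_v u_neq_w {fvw w2}.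
case: v => [[[|[|//]] ?] [[|[|//]] ?]] //;
case: w => [[[|[|//]] ?] [[|[|//]] ?]] //;
by case: u => [[[|[|//]] ?] [[|[|//]] ?]] // *; congr (_, _); apply: val_inj.
Qed.

(** The right-hand side evaluates when [m] and [n] are numerals. *)
Lemma card_Zp_torsion (m n : nat) :
  #|[set z : 'Z_m.+2 | z *+ n == 0]| = (\sum_(i < m.+2) (n * i %% m.+2 == 0))%N.
Proof.
rewrite -sum1dep_card big_mkcond /=; apply: eq_bigr => i _.
have -> : (i *+ n == 0) = (n * i %% m.+2 == 0)%N; last by case: (_ == _).
by rewrite Zp_mulrn -val_eqE /= mulnC.
Qed.

(** * The brace of order 12 *)

(** This is x + y + x * y for the product of a nilpotent ring: Z_3 with zero
    product, times the ideal generated by X in F_2[X]/(X^3). *)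
Definition brace12 : Type := ('Z_3 * 'Z_2 * 'Z_2)%type.

HB.instance Definition _ := GRing.Zmodule.copy brace12 ('Z_3 * 'Z_2 * 'Z_2)%type.
HB.instance Definition _ := Finite.copy brace12 ('Z_3 * 'Z_2 * 'Z_2)%type.

Definition brace12_mul (b c : brace12) : brace12 :=
  b + c + (0, 0, b.1.2 * c.1.2).
Definition brace12_inv (b : brace12) : brace12 := - b + (0, 0, b.1.2 * b.1.2).

Fact brace12_mulA : associative brace12_mul.
Proof.
by move=> [[u x] y] [[v x'] y'] [[w x''] y'']; congr (_, _, _) => /=; ring.
Qed.

Fact brace12_mul1b : left_id 0 brace12_mul.
Proof. by move=> [[u x] y]; congr (_, _, _) => /=; ring. Qed.

Fact brace12_mulVb : left_inverse 0 brace12_inv brace12_mul.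
Proof. by move=> [[u x] y]; congr (_, _, _) => /=; ring. Qed.

Fact brace12_mulDr (a b c : brace12) :
  brace12_mul a (b + c) = brace12_mul a b - a + brace12_mul a c.
Proof.
case: a b c => [[u x] y] [[v x'] y'] [[w x''] y''].
by congr (_, _, _) => /=; ring.
Qed.

HB.instance Definition _ := Zmodule_isLeftBrace.Build brace12
  brace12_mulA brace12_mul1b brace12_mulVb brace12_mulDr.

Lemma card_brace12 : #|{: brace12}| = 12%N.
Proof. by rewrite !card_prod !card_ord. Qed.

(** The element (0, 1, 0) has order 4 and square (0, 0, 1), so x + 2 y is its
    logarithm; 4 and 9 are the idempotents of Z_12 that glue the parts of orders
    3 and 4. *)
Definition dlog (b : mul_group brace12) : 'Z_12 :=
  inZp (4 * b.1.1 + 9 * (b.1.2 + 2 * b.2)).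

Lemma dlogM : {morph dlog : b c / (b * c)%g >-> b + c}.
Proof.
move=> [[u x] y] [[v x'] y'].
case: u => [[|[|[|//]]] ?]; case: x => [[|[|//]] ?]; case: y => [[|[|//]] ?];
case: v => [[|[|[|//]]] ?]; case: x' => [[|[|//]] ?]; case: y' => [[|[|//]] ?];
exact: val_inj.
Qed.

Lemma dlog_inj : injective dlog.
Proof.
move=> [[u x] y] [[v x'] y'].
case: u => [[|[|[|//]]] ?]; case: x => [[|[|//]] ?]; case: y => [[|[|//]] ?];
case: v => [[|[|[|//]]] ?]; case: x' => [[|[|//]] ?]; case: y' => [[|[|//]] ?];
by move/(congr1 val) => //= _; congr (_, _, _); apply: val_inj.
Qed.

(** * The model braces *)

Section Model.

Variables (p : nat) (t : {unit 'Z_p}).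
Hypothesis t12 : (t ^+ 12 = 1)%g.

Definition dlog_expg (b : mul_group brace12) : {unit 'Z_p} := (t ^+ dlog b)%g.

Fact dlog_expgM :
  {in [set: mul_group brace12] &, {morph dlog_expg : b c / (b * c)%g}}.
Proof. by move=> b c _ _; rewrite /dlog_expg dlogM expg_Zp12D. Qed.

Definition twist : {morphism [set: mul_group brace12] >-> {unit 'Z_p}} :=
  Morphism dlog_expgM.

Definition sdprod12 : finLeftBraceType := brace_sdprod twist.

Lemma card_ker_twist : #|('ker twist)%g| = (12 %/ #[t]%g)%N.
Proof.
have card12 : #|[set: mul_group brace12]| = 12%N by rewrite cardsT card_brace12.
have := card_morphim twist [set: mul_group brace12]; rewrite setIid => imE.
have im_t : (twist @* [set: mul_group brace12] = <[t]>)%g.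
  apply/eqP; rewrite eqEsubset; apply/andP; split.
    by apply/subsetP=> _ /morphimP[b _ _ ->]; apply: mem_cycle.
  (* The element (1, 1, 0) has logarithm 4 + 9 = 1 modulo 12. *)
  by rewrite cycle_subG; apply/morphimP; exists (1, 1, 0); rewrite ?inE.
have := Lagrange (subsetT ('ker twist)%g).
by rewrite -imE im_t -orderE card12 => <-; rewrite mulnK ?order_gt0.
Qed.

(** Actions of groups are on the right, whereas a brace acts on the left: hence
    the inverse. *)
Definition unit_scale (x : 'Z_p) (a : 'Z_12) : 'Z_p := val (t ^- a)%g * x.

Fact unit_scale_is_action : is_action [set: 'Z_12] unit_scale.
Proof.
split=> [a x y|x a b _ _]; first exact: (mulrI (valP (t ^- a)%g)).
by rewrite /unit_scale mulrA -FinRing.val_unitM -invMg -expg_Zp12D.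
Qed.

Fact unit_scale_is_groupAction :
  is_groupAction [set: 'Z_p] (Action unit_scale_is_action).
Proof.
move=> a _; rewrite inE; apply/andP; split.
  by apply/subsetP=> x; rewrite inE.
by apply/morphicP=> x y _ _; rewrite !actpermE; apply: mulrDr.
Qed.

Definition scaling : groupAction [set: 'Z_12] [set: 'Z_p] :=
  GroupAction unit_scale_is_groupAction.

(** The pair (a, x) of the external semidirect product stands for a * x, and the
    pair (x, b) of the brace for x * b = b * x ^ b: this is where the factor
    t ^- dlog b comes from. *)
Lemma sdprod12_mul_isog :
  [set: mul_group sdprod12] \isog [set: sdprod_by scaling].
Proof.
have mem_set (v : 'Z_12 * 'Z_p) : v \in setX [set: 'Z_12] [set: 'Z_p].
  by case: v => a x; rewrite !inE.
pose f (u : mul_group sdprod12) : sdprod_by scaling :=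
  SdPair scaling (mem_set (dlog u.2, val (t ^- dlog u.2)%g * u.1)).
have fM : {morph f : u v / (u * v)%g}.
  move=> [x b] [y c]; apply: val_inj.
  have dlogE : dlog (bmul b c) = dlog b + dlog c by apply: dlogM.
  congr pair => //.
  change (val (t ^- dlog (bmul b c))%g * (x + val (t ^+ dlog b)%g * y) =
    val (t ^- dlog c)%g * (val (t ^- dlog b)%g * x) + val (t ^- dlog c)%g * y).
  rewrite dlogE expg_Zp12D // invMg.
  rewrite FinRing.val_unitM mulrDr -!mulrA; congr (_ + _).
  by rewrite [X in _ * X]mulrA -FinRing.val_unitM mulVg mul1r.
apply: (isog_setT fM) => [[x b] [y c] /(congr1 val) fE|].
  have /dlog_inj eq_bc : dlog b = dlog c := congr1 fst fE.
  move: (congr1 snd fE) => /=.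
  by rewrite eq_bc => /(mulrI (valP (t ^- dlog c)%g)) ->.
apply: leq_trans (leq_card _ val_inj) _.
by rewrite card_prod [in leqRHS]card_prod card_brace12 !card_ord mulnC.
Qed.

Lemma sdprod12_add_isog :
  [set: (sdprod12 : finZmodType)] \isog [set: 'Z_p * 'Z_6 * 'Z_2].
Proof.
pose k (u : 'Z_3 * 'Z_2) : 'Z_6 := inZp (4 * u.1 + 3 * u.2).
have kD : {morph k : u v / u + v}.
  move=> [u x] [v y]; apply: val_inj.
  case: u => [[|[|[|//]]] ?]; case: x => [[|[|//]] ?];
  by case: v => [[|[|[|//]]] ?]; case: y => [[|[|//]] ?].
have k_inj : injective k.
  move=> [u x] [v y]; case: u => [[|[|[|//]]] ?]; case: x => [[|[|//]] ?];
  case: v => [[|[|[|//]]] ?]; case: y => [[|[|//]] ?];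
  by move/(congr1 val) => //= _; congr (_, _); apply: val_inj.
pose f (u : (sdprod12 : finZmodType)) : 'Z_p * 'Z_6 * 'Z_2 :=
  (u.1, k u.2.1, u.2.2).
have fM : {morph f : u v / (u * v)%g}.
  by move=> [x [b y]] [x' [c y']]; congr (_, _, _); apply: kD.
apply: (isog_setT fM) => [[x [b y]] [x' [c y']] fE|].
  have /k_inj eq_bc : k b = k c := congr1 (fun v => v.1.2) fE.
  have [eq_x eq_y] := (congr1 (fun v => v.1.1) fE, congr1 snd fE).
  by rewrite /= in eq_x eq_y; rewrite eq_x eq_y eq_bc.
by rewrite !card_prod !card_ord -!mulnA.
Qed.

End Model.

(** * The lambda maps of a brace and its torsion subgroups *)

Section Lambda.

Variable B : finLeftBraceType.
Implicit Types x y z : B.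

Definition lam x y : B := bmul x y - x.

Lemma bmulE x y : bmul x y = x + lam x y.
Proof. by rewrite addrC subrK. Qed.

Lemma lamD x : {morph lam x : y z / y + z}.
Proof. by move=> y z; rewrite /lam bmulDr addrA. Qed.

Lemma lam0 x : lam x 0 = 0.
Proof. exact: additive0 (lamD x). Qed.

Lemma lamMn x y n : lam x (y *+ n) = lam x y *+ n.
Proof. exact: additiveMn (lamD x) y n. Qed.

Lemma bone0 : bone = 0 :> B.
Proof. by rewrite -[LHS]bmulb0 bmul1b. Qed.

Lemma lam1 y : lam bone y = y.
Proof. by rewrite /lam bmul1b bone0 subr0. Qed.

Lemma lamM x y z : lam (bmul x y) z = lam x (lam y z).
Proof.
apply: (@addrI _ (bmul x y)); rewrite -bmulE -bmulA.
by rewrite [in LHS]bmulE [bmul y z]bmulE lamD addrA -bmulE.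
Qed.

Fact group_set_torsion n :
  group_set [set x : mul_group B | (x : B) *+ n == 0].
Proof.
apply/group_setP; split=> [|x y]; rewrite !inE.
  by rewrite [1%g]bone0 mul0rn.
move=> /eqP xn /eqP yn.
by rewrite [(x * y)%g]bmulE mulrnDl -lamMn xn yn lam0 addr0.
Qed.

(** The torsion is an additive notion, but it is taken as a subgroup for the
    multiplication. *)
Definition torsion n : {group mul_group B} := Group (group_set_torsion n).

Lemma torsionP n x : reflect (x *+ n = 0) (x \in torsion n).
Proof. by rewrite inE; apply: eqP. Qed.

Lemma lam_torsion n x y : y \in torsion n -> lam x y \in torsion n.
Proof. by move/torsionP=> yn; apply/torsionP; rewrite -lamMn yn lam0. Qed.

Definition lam_act (y x : mul_group B) : mul_group B := lam (x^-1)%g y.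

Fact lam_act_is_action : is_action [set: mul_group B] lam_act.
Proof.
split=> [x y z eq_yz|y u v _ _]; last by rewrite /lam_act invMg [LHS]lamM.
by rewrite -[y]lam1 -[z]lam1 -[bone](mulgV x) !lamM [lam _ y]eq_yz.
Qed.

(** The orbits have 1 or #|G| elements, and the second is too many for [S]. *)
Lemma lam_fix (G : {group mul_group B}) (S : {set mul_group B}) x y :
    prime #|G| -> (#|S| < #|G|)%N ->
    (forall u v, u \in G -> v \in S -> lam u v \in S) ->
  x \in G -> y \in S -> lam x y = y.
Proof.
move=> q_prime lt_SG lamS Gx Sy; pose to := Action lam_act_is_action.
have sorbS : orbit to G y \subset S.
  by apply/subsetP=> _ /orbitP[u Gu <-]; apply: lamS; rewrite ?groupV.
have /card_orbit1 orb1: #|orbit to G y| = 1%N.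
  have [_ /(_ _ (dvdn_orbit to G y))/pred2P[] // orb_q] := primeP q_prime.
  by have := subset_leq_card sorbS; rewrite orb_q leqNgt lt_SG.
have: to y (x : mul_group B)^-1%g \in orbit to G y by rewrite mem_orbit ?groupV.
by rewrite orb1 inE /= /lam_act invgK => /eqP.
Qed.

(** [lam_fix] applies to the nonzero elements: there are only q - 1 of them. *)
Lemma lam_prime q x y : prime q -> #|torsion q| = q ->
  x \in torsion q -> y \in torsion q -> lam x y = y.
Proof.
move=> q_prime card_q Tx Ty.
have [-> | y_neq0] := eqVneq y 0; first exact: lam0.
apply: (@lam_fix (torsion q) (torsion q :\ (0 : mul_group B)) x y) => //.
- by rewrite card_q.
- by apply: proper_card; rewrite properD1 // -[0]bone0 group1.
- move=> u v Tu; rewrite !in_setD1 => /andP[v_neq0 Tv].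
  rewrite lam_torsion // andbT.
  apply: contra v_neq0 => /eqP uv0.
  by rewrite -[v]lam1 -[bone](mulVg (u : mul_group B)) lamM uv0 lam0.
- by rewrite in_setD1 y_neq0.
Qed.

End Lambda.

(** * Uniqueness of the brace of order 12 *)

(** The isomorphism [gam] parametrises the multiplicative group of T_12. The
    orders of T_2 and T_3 carry all the information needed on its addition: a
    group of exponent 2 and order 4 is a Klein group. *)
Section Cyclic12.

Variables (B : finLeftBraceType) (gam : 'Z_12 -> B).
Hypothesis gamD : forall z w, gam (z + w) = bmul (gam z) (gam w).
Hypothesis gam_inj : injective gam.
Hypothesis gam_onto : forall x : B, x *+ 12 = 0 -> exists z, x = gam z.

Lemma gam0 : gam 0 = 0.
Proof.
rewrite -[RHS](bone0 B); apply: (@mulgI (mul_group B) (gam 0)).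
by rewrite mulg1 -[LHS]gamD addr0.
Qed.

Lemma gamX z n : gam (z *+ n) = ((gam z : mul_group B) ^+ n)%g.
Proof.
elim: n => [|n IHn]; first by rewrite mulr0n gam0 -bone0.
by rewrite mulrS gamD IHn expgS.
Qed.

(** The cyclic group Z_12 has a single subgroup of each order, so the order of
    an additive torsion subgroup says which powers of the generator it has. *)
Lemma torsion_gam n N :
    (n %| 12)%N -> #|torsion B n| = N -> #|[set z : 'Z_12 | z *+ N == 0]| = N ->
  torsion B n = gam @: [set z | z *+ N == 0] :> {set _}.
Proof.
move=> /dvdnP[k def12] cardT cardZ; apply/eqP.
rewrite eqEcard cardT card_imset // cardZ leqnn andbT.
apply/subsetP=> x Tx; have xn := torsionP _ _ Tx.
have [|z def_x] := gam_onto (x := x).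
  by rewrite def12 mulnC mulrnA xn mul0rn.
rewrite def_x imset_f // inE -(inj_eq gam_inj) gamX -def_x gam0.
by rewrite -cardT expg_cardG // [1%g]bone0.
Qed.

Hypothesis card2 : #|torsion B 2| = 4%N.
Hypothesis card3 : #|torsion B 3| = 3%N.

Lemma torsion2_gam : torsion B 2 = gam @: [set z | z *+ 4 == 0] :> {set _}.
Proof.
by apply: torsion_gam; rewrite // card_Zp_torsion !big_ord_recl big_ord0.
Qed.

Lemma torsion3_gam : torsion B 3 = gam @: [set z | z *+ 3 == 0] :> {set _}.
Proof.
by apply: torsion_gam; rewrite // card_Zp_torsion !big_ord_recl big_ord0.
Qed.

(** For r in T_3 and s in T_2, r s = s r means r + lam r s = s + lam s r; then
    r - lam s r = s - lam r s lies in T_2 and in T_3, so it is 0. *)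
Lemma gam_add34 z w :
  z *+ 3 = 0 -> w *+ 4 = 0 -> gam (z + w) = gam z + gam w.
Proof.
move=> z3 w4.
have Tz : gam z \in torsion B 3 by rewrite torsion3_gam imset_f // inE z3.
have Tw : gam w \in torsion B 2 by rewrite torsion2_gam imset_f // inE w4.
have eq_zw : gam z - lam (gam w) (gam z) = gam w - lam (gam z) (gam w).
  apply/eqP; rewrite subr_eq addrAC eq_sym subr_eq -!bmulE.
  by rewrite -!gamD addrC.
have /subr0_eq lam_w: gam w - lam (gam z) (gam w) = 0.
  apply: (@coprime_torsion _ _ 2 3) => //.
    by rewrite mulrnBl -lamMn (torsionP _ _ Tw) lam0 subrr.
  by rewrite -eq_zw mulrnBl -lamMn (torsionP _ _ Tz) lam0 subrr.
by rewrite gamD bmulE -lam_w.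
Qed.

Lemma gam_dlogD (b c : brace12) :
  gam (dlog (b + c : brace12)) = gam (dlog b) + gam (dlog c).
Proof.
pose z (u : 'Z_3) : 'Z_12 := inZp (4 * u).
pose w (v : 'Z_2 * 'Z_2) : 'Z_12 := inZp (9 * (v.1 + 2 * v.2)).
have z3 u : z u *+ 3 = 0 by apply: val_inj; case: u => [[|[|[|//]]] ?].
have w4 v : w v *+ 4 = 0.
  by apply: val_inj; case: v => [[[|[|//]] ?] [[|[|//]] ?]].
have dlogE (d : brace12) : gam (dlog d) = gam (z d.1.1) + gam (w (d.1.2, d.2)).
  by rewrite -gam_add34 //; congr gam; apply: val_inj; rewrite /= modnDm.
have zD : {morph gam \o z : u v / u + v}.
  move=> u v /=; have -> : z (u + v) = z u + z v.
    by apply: val_inj; case: u v => [[|[|[|//]]] ?] [[|[|[|//]]] ?].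
  have Tz s : gam (z s) \in torsion B 3.
    by rewrite torsion3_gam imset_f // inE z3.
  by rewrite gamD bmulE (lam_prime _ card3).
have wD : {morph gam \o w : u v / u + v}.
  have Tw v : gam (w v) \in torsion B 2.
    by rewrite torsion2_gam imset_f // inE w4.
  apply: klein_additive => [u v /gam_inj/(congr1 val)||v|u v] /=.
  - case: u => [[[|[|//]] ?] [[|[|//]] ?]];
    case: v => [[[|[|//]] ?] [[|[|//]] ?]];
    by move=> //= _; congr (_, _); apply: val_inj.
  - by rewrite -gam0; congr gam; apply: val_inj.
  - by rewrite -mulr2n (torsionP _ _ (Tw v)).
  - have: gam (w u) + gam (w v) \in torsion B 2.
      by apply/torsionP; rewrite mulrnDl !(torsionP _ _ (Tw _)) addr0.
    rewrite torsion2_gam => /imsetP[s]; rewrite inE => s4 ->.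
    suff [v' ->] : exists v', s = w v' by exists v'.
    (* The elements of order dividing 4 are 0, 3 = 27, 6 = 18 and 9. *)
    case: s s4 => [[|[|[|[|[|[|[|[|[|[|[|[|//]]]]]]]]]]]] ?] // _.
    + by exists (0, 0); apply: val_inj.
    + by exists (1, 1); apply: val_inj.
    + by exists (0, 1); apply: val_inj.
    + by exists (1, 0); apply: val_inj.
rewrite !dlogE [gam (z _)]zD [gam (w _)](wD (_, _) (_, _)) /=.
by rewrite addrACA.
Qed.

End Cyclic12.

(** * Every brace with the given groups is a model *)

Section Reconstruct.

Variables (p : nat) (B : finLeftBraceType).
Variables (i : 'Z_p -> B) (gam : 'Z_12 -> B) (t : {unit 'Z_p}).
Hypotheses (t12 : (t ^+ 12 = 1)%g) (co_p12 : coprime p 12) (p_gt1 : (1 < p)%N).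
Hypothesis iD : {morph i : a b / a + b}.
Hypothesis i_inj : injective i.
Hypothesis gamD : forall z w, gam (z + w) = bmul (gam z) (gam w).
Hypothesis gam_inj : injective gam.
Hypothesis gam12 : forall z, gam z *+ 12 = 0.
Hypothesis gam_onto : forall x : B, x *+ 12 = 0 -> exists z, x = gam z.
Hypotheses (card2 : #|torsion B 2| = 4%N) (card3 : #|torsion B 3| = 3%N).
Hypothesis cardB : #|B| = (12 * p)%N.
Hypothesis lam_i : forall a x, lam (i a) x = x.
Hypothesis lam_gam1 : forall a, lam (gam 1) (i a) = i (val t * a).

Lemma lam_gam z a : lam (gam z) (i a) = i (val (t ^+ z)%g * a).
Proof.
rewrite -{1}[z]natr_Zp; elim: (z : nat) a => [|n IHn] a.
  by rewrite mulr0n (gam0 gamD) -{1}(bone0 B) lam1 mul1r.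
by rewrite mulrS gamD lamM IHn lam_gam1 mulrA expgS.
Qed.

Lemma brace_iso_sdprod12 : brace_iso B (sdprod12 t12).
Proof.
apply: brace_iso_sym.
pose phi (u : sdprod12 t12) : B := i u.1 + gam (dlog u.2).
have bmul_i a x : bmul (i a) x = i a + x by rewrite bmulE lam_i.
have i_torsion a : i a *+ p = 0.
  by rewrite -(additiveMn iD) -mulr_natr pchar_Zp // mulr0 (additive0 iD).
exists phi; split.
- apply: inj_card_bij; last first.
    by rewrite cardB card_prod card_brace12 card_ord Zp_cast // mulnC.
  move=> [a b] [a' b'] /= eq_phi.
  have d0 : i a - i a' = gam (dlog b') - gam (dlog b).
    apply/eqP; rewrite subr_eq addrAC eq_sym subr_eq eq_sym [_ + i a']addrC.
    by apply/eqP.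
  have /subr0_eq/i_inj eq_a : i a - i a' = 0.
    apply: (@coprime_torsion _ _ p 12) => //; first exact: ltnW.
      by rewrite mulrnBl !i_torsion subrr.
    by rewrite d0 mulrnBl !gam12 subrr.
  move: d0; rewrite eq_a subrr => /esym/subr0_eq/gam_inj/dlog_inj eq_b.
  by rewrite eq_b.
- move=> [a b] [a' b']; rewrite /phi /= iD.
  by rewrite [gam _](gam_dlogD gamD gam_inj gam_onto card2 card3) addrACA.
- move=> [a b] [a' b']; rewrite /phi /=.
  rewrite [dlog _]dlogM gamD iD -[in RHS]bmul_i -bmulA bmul_i -addrA.
  by rewrite bmulDr -/(lam _ _) lam_gam.
Qed.

End Reconstruct.

Lemma additive_structure p (B : finLeftBraceType) :
    (1 < p)%N -> coprime p 12 ->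
    [set: (B : finZmodType)] \isog [set: 'Z_p * 'Z_6 * 'Z_2] ->
  [/\ #|B| = (12 * p)%N,
      [/\ #|torsion B 2| = 4%N, #|torsion B 3| = 3%N & #|torsion B 12| = 12%N]
    & exists i : 'Z_p -> B,
      [/\ {morph i : a b / a + b}, injective i,
          torsion B p = i @: [set: 'Z_p] :> {set _}
        & forall x, exists a, exists2 y, y *+ 12 = 0 & x = i a + y]].
Proof.
move=> p_gt1 co_p12 isoD.
have [co_p2 co_p3] : coprime p 2 /\ coprime p 3.
  by move: co_p12; rewrite -[12%N]/(2 * 2 * 3)%N !coprimeMr => /andP[/andP[]].
have [F F_bij FD] : exists2 F : B -> 'Z_p * 'Z_6 * 'Z_2,
  bijective F & {morph F : x y / x + y} := isog_setT_bij isoD.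
have [G FK GK] := F_bij.
have GD : {morph G : x y / x + y}.
  by move=> x y; apply: (can_inj FK); rewrite FD !GK.
have F0 := additive0 FD; have FMn := additiveMn FD.
have Zp0 (a : 'Z_p) : a *+ p = 0 by rewrite -mulr_natr pchar_Zp ?mulr0.
have Z6_12 (b : 'Z_6) : b *+ 12 = 0.
  by apply: val_inj; case: b => [[|[|[|[|[|[|//]]]]]] ?].
have Z2_12 (c : 'Z_2) : c *+ 12 = 0 by apply: val_inj; case: c => [[|[|//]] ?].
have card_torsion n : coprime p n -> #|torsion B n| =
    muln #|[set z : 'Z_6 | z *+ n == 0]| #|[set z : 'Z_2 | z *+ n == 0]|.
  move=> co_pn; rewrite -(card_imset _ (can_inj FK)).
  transitivity #|setX (setX [set (0 : 'Z_p)] [set z : 'Z_6 | z *+ n == 0])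
                      [set z : 'Z_2 | z *+ n == 0]|; last first.
    by rewrite !cardsX cards1 mul1n.
  apply: eq_card => w; rewrite -[w]GK (mem_imset _ _ (can_inj FK)) inE.
  rewrite -(inj_eq (can_inj FK)) FMn F0 GK.
  case: w => [[a b] c]; rewrite !inE !pairMn /=.
  have -> // : (a == 0) = (a *+ n == 0).
  apply/eqP/eqP => [-> | an]; first exact: mul0rn.
  by apply: (coprime_torsion _ co_pn); rewrite ?Zp0 // ltnW.
split.
- by rewrite (bij_eq_card F_bij) !card_prod !card_ord Zp_cast // -mulnA mulnC.
- by split; rewrite card_torsion // !card_Zp_torsion !big_ord_recl !big_ord0.
exists (fun a => G (a, 0, 0)); split=> [a b|a b /(can_inj GK)[]//||x].
- by rewrite -GD; congr G; congr (_, _, _); rewrite addr0.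
- apply/setP=> x; apply/torsionP/imsetP => [xp | [a _ ->]].
    exists (F x).1.1; rewrite ?inE //; apply: (can_inj FK); rewrite GK.
    have := congr1 F xp; rewrite FMn F0; case: (F x) => [[a b] c] /=.
    rewrite !pairMn => -[_ bp cp]; congr (_, _, _);
      by apply: (coprime_torsion _ co_p12); rewrite ?Z6_12 ?Z2_12 // ltnW.
  by apply: (can_inj FK); rewrite FMn F0 GK !pairMn !mul0rn Zp0.
- exists (F x).1.1, (G (0, (F x).1.2, (F x).2)); apply: (can_inj FK).
    by rewrite FMn F0 GK !pairMn mul0rn Z6_12 Z2_12.
  rewrite FD !GK; case: (F x) => [[a b] c].
  by congr (_, _, _); rewrite /= ?addr0 ?add0r.
Qed.

Lemma sdprod_projection p (gT : finGroupType)
    (to : groupAction [set: 'Z_12] [set: 'Z_p]) :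
    (1 < p)%N -> [set: gT] \isog [set: sdprod_by to] ->
  exists2 psi : gT -> 'Z_12, {morph psi : x y / (x * y)%g >-> x + y}
    & forall x, psi x = 0 -> (x ^+ p = 1)%g.
Proof.
move=> p_gt1 /isog_setT_bij[f [f' fK _] fM].
exists (fun x => (f x).1) => [x y|x psi0]; first by rewrite fM.
apply: (can_inj fK); rewrite (multiplicativeX fM) (multiplicative1 fM).
rewrite [f x]sdpairE psi0 morph1 mul1g -morphX ?inE //.
rewrite -[RHS](morph1 (sdpair1_morphism to)); congr sdpair1.
by rewrite Zp_expg -Zp_mulrn -mulr_natr pchar_Zp ?mulr0.
Qed.

(** The unit t describes the action of one generator of Z_12 on the p-torsion;
    the exponent k accounts for the choice of another generator. *)
Lemma has_groups_sdprod12 p (B : finLeftBraceType) :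
    prime p -> coprime p 12 -> has_groups_Zp62_ZpZ12 p B ->
  exists2 t : {unit 'Z_p}, (t ^+ 12 = 1)%g &
    forall k (u : {unit 'Z_p}) (u12 : (u ^+ 12 = 1)%g),
      coprime k 12 -> u = (t ^+ k)%g -> brace_iso B (sdprod12 u12).
Proof.
move=> p_pr co_p12 [isoD [act isoM]]; have p_gt1 := prime_gt1 p_pr.
have [cardB [card2 card3 card12] [i [iD i_inj torsion_p decomp]]] :=
  additive_structure p_gt1 co_p12 isoD.
have [psi psiM psi_ker] := sdprod_projection p_gt1 isoM.
have torsion_i (x : B) : x \in torsion B p -> exists a, x = i a.
  by rewrite torsion_p => /imsetP[a _ ->]; exists a.
have i_torsion a : i a \in torsion B p by rewrite torsion_p imset_f ?inE.
have card_p : #|torsion B p| = p.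
  by rewrite torsion_p card_imset // cardsT card_ord Zp_cast.
have psi1 : psi 1%g = 0.
  by apply: (@addrI _ (psi 1%g)); rewrite -psiM mulg1 addr0.
have psiX x n : psi (x ^+ n)%g = psi x *+ n.
  by elim: n => [|n IHn]; rewrite ?psi1 // expgS psiM IHn mulrS.
(* The kernel of psi has exponent p, the subgroup T_12 has order 12. *)
have psi_inj12 : {in torsion B 12 &, injective psi}.
  move=> x y Tx Ty eq_psi; apply/(mulgI x^-1%g); rewrite mulVg.
  apply/esym/(coprime_expg_eq1 co_p12).
    by apply: psi_ker; rewrite psiM -eq_psi -psiM mulVg psi1.
  by rewrite -card12 expg_cardG // groupM ?groupV.
have Z12_12 (z : 'Z_12) : z *+ 12 = 0.
  by rewrite -mulr_natr (pchar_Zp (isT : 1 < 12)%N) mulr0.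
have psi_i a : psi (i a) = 0.
  apply: (coprime_torsion _ co_p12); rewrite ?Z12_12 //; first exact: ltnW.
  by rewrite -psiX -card_p expg_cardG // card_p psi1.
have [gam gamP] : exists gam : 'Z_12 -> B,
    forall z, gam z \in torsion B 12 /\ psi (gam z) = z.
  apply: (@fin_all_exists _ (fun=> B : Type)
    (fun z x => x \in torsion B 12 /\ psi x = z)) => z.
  suff: z \in psi @: torsion B 12 by case/imsetP=> x Tx ->; exists x.
  have -> : psi @: torsion B 12 = setT.
    apply/eqP; rewrite eqEcard subsetT cardsT card_ord card_in_imset //.
    by rewrite card12.
  by rewrite inE.
have gamT z : gam z \in torsion B 12 by have [] := gamP z.
have psi_gam z : psi (gam z) = z by have [] := gamP z.
have gamD z w : gam (z + w) = bmul (gam z) (gam w).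
  apply: psi_inj12 => //; first exact: groupM (gamT z) (gamT w).
  by rewrite psi_gam [RHS]psiM !psi_gam.
have gam_inj : injective gam by apply: can_inj psi_gam.
have gam_onto (x : B) : x *+ 12 = 0 -> exists z, x = gam z.
  move=> x12; exists (psi x); apply: psi_inj12; rewrite ?psi_gam //.
  exact/torsionP.
(* With x in T_p, y in T_12 and y' = lam x y, also in T_12, the product x y is
   y' + x = y' x' for some x' in T_p; applying psi gives y = y'. *)
have lam_i_gam a z : lam (i a) (gam z) = gam z.
  have [|z' def_z'] := gam_onto (lam (i a) (gam z)).
    by rewrite -lamMn (torsionP _ _ (gamT z)) lam0.
  have : lam (binv (gam z')) (i a) \in torsion B p by apply: lam_torsion.
  case/torsion_i => a' def_a'.
  have eq_mul : bmul (i a) (gam z) = bmul (gam z') (i a').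
    rewrite !bmulE def_z' addrC -def_a' -lamM.
    by rewrite [bmul _ _](mulgV (gam z' : mul_group B)) [lam _ _]lam1.
  have := congr1 psi eq_mul; rewrite [LHS]psiM [RHS]psiM !psi_i !psi_gam.
  by rewrite add0r addr0 def_z' => <-.
have lam_i a x : lam (i a) x = x.
  have [a' [y /gam_onto[z ->] ->]] := decomp x.
  by rewrite lamD lam_i_gam (lam_prime p_pr card_p).
have [s lam_s] : exists s, lam (gam 1) (i 1) = i s.
  by apply: torsion_i; apply: lam_torsion.
have lamX n a : lam (gam n%:R) (i a) = i (s ^+ n * a).
  elim: n a => [|n IHn] a.
    by rewrite mulr0n (gam0 gamD) -{1}(bone0 B) lam1 mul1r.
  rewrite mulrS gamD lamM IHn -[_ * a]natr_Zp (additiveMn iD) lamMn lam_s.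
  by rewrite -(additiveMn iD) -mulr_natr natr_Zp mulrA exprS.
have s12 : s ^+ 12 = 1.
  apply: i_inj; rewrite -[s ^+ 12]mulr1 -lamX Z12_12.
  by rewrite (gam0 gamD) -{1}(bone0 B) lam1.
have s_unit : s \is a GRing.unit.
  by apply/unitrPr; exists (s ^+ 11); rewrite -exprS.
pose t : {unit 'Z_p} := FinRing.unit 'Z_p s_unit.
have valX n : val (t ^+ n)%g = s ^+ n by rewrite FinRing.val_unitX.
exists t; first by apply: val_inj; rewrite valX s12.
move=> k u u12 co_k12 def_u.
have mulk_inj : injective (fun z : 'Z_12 => z *+ k).
  move=> z w /eqP; rewrite -subr_eq0 -mulrnBl => /eqP zw.
  apply/subr0_eq; apply: (@coprime_torsion _ _ 12 k) => //.
  by rewrite coprime_sym.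
apply: (@brace_iso_sdprod12 p B i (fun z => gam (z *+ k))) => //.
- by move=> z w; rewrite mulrnDl gamD.
- exact: inj_comp gam_inj mulk_inj.
- by move=> z; apply/torsionP.
- move=> x /gam_onto[z ->]; have [h _ hK] := injF_bij mulk_inj.
  by exists (h z); rewrite hK.
- by move=> a; rewrite lamX def_u valX.
Qed.

(** * Classification by the order of the twist *)

(** The reduction from the units modulo 12 to those modulo d is surjective. *)
Lemma coprime_lift12 d k : (d %| 12)%N -> coprime k d ->
  exists2 k', coprime k' 12 & k' = k %[mod d].
Proof.
move=> d_dv co_kd; have d_gt0 : (0 < d)%N by apply: dvdn_gt0 d_dv.
have co_r : coprime (k %% d) d by rewrite coprime_modl.
suff: exists2 k', coprime k' 12 & (k' %% d = k %% d)%N by [].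
move: (k %% d)%N (ltn_pmod k d_gt0) co_r => r.
have : (d \in [:: 1; 2; 3; 4; 6; 12])%N by move: d_dv; rewrite dvdn_divisors.
rewrite !inE => /or4P[/eqP->|/eqP->|/eqP->|/or3P[/eqP->|/eqP->|/eqP->]];
  move: r; do 12?[case=> //]; move=> *;
  solve [by exists 1%N | by exists 5%N | by exists 7%N | by exists 11%N].
Qed.

Lemma same_order_expg (gT : finGroupType) (A : {group gT}) (t u : gT) :
    cyclic A -> t \in A -> u \in A -> #[t]%g = #[u]%g -> (#[t]%g %| 12)%N ->
  exists2 k, coprime k 12 & (u = t ^+ k)%g.
Proof.
move=> cycA At Au eq_ord t12.
have eq_cyc : (<[t]> = <[u]>)%g.
  apply/eqP; rewrite (eq_subG_cyclic cycA) ?cycle_subG //.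
  by rewrite -!orderE eq_ord.
have /cycleP[k def_u] : (u \in <[t]>)%g by rewrite eq_cyc cycle_id.
have co_k : coprime k #[t]%g.
  by rewrite coprime_sym -generator_coprime /generator -def_u eq_cyc.
have [k' co_k' eq_k'] := coprime_lift12 t12 co_k.
by exists k'; rewrite // def_u -(expg_mod_order t k) -eq_k' expg_mod_order.
Qed.

Lemma units_Zp_exists_order p d : prime p -> (d %| gcdn 12 p.-1)%N ->
  exists2 t : {unit 'Z_p}, (t ^+ 12 = 1)%g & #[t]%g = d.
Proof.
move=> p_pr; rewrite dvdn_gcd => /andP[d12 dp].
have [g def_g] := cyclicP (units_Zp_cyclic p_pr).
have ord_g : #[g]%g = p.-1.
  by rewrite orderE -def_g card_units_Zp ?prime_gt0 // totient_prime.
have p1_gt0 : (0 < p.-1)%N by rewrite -ord_g order_gt0.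
have ord_d : #[g ^+ (p.-1 %/ d)]%g = d.
  by rewrite orderXdiv ord_g ?dvdn_div // divnA // mulKn.
by exists (g ^+ (p.-1 %/ d))%g; first by apply/eqP; rewrite -order_dvdn ord_d.
Qed.

Lemma divn_dvd_inj n d e :
    (0 < n)%N -> (d %| n)%N -> (e %| n)%N ->
  (n %/ d)%N = (n %/ e)%N -> d = e.
Proof.
move=> n_gt0 dn en eq_div; apply/eqP.
have q_gt0 : (0 < n %/ d)%N.
  by rewrite divn_gt0 ?(dvdn_gt0 n_gt0 dn) // (dvdn_leq n_gt0 dn).
by rewrite -(eqn_pmul2l q_gt0) {2}eq_div !divnK.
Qed.

Lemma classification p n (ds : n.-tuple nat) :
    prime p -> coprime p 12 -> uniq ds -> ds =i divisors (gcdn 12 p.-1) ->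
  exists Bs : 'I_n -> finLeftBraceType,
    [/\ iso_representatives (has_groups_Zp62_ZpZ12 p) Bs,
        forall i, tnth ds i = 1%N -> is_direct_product p (Bs i)
      & forall i, has_kernel_of_order p (Bs i) (12 %/ tnth ds i)].
Proof.
move=> p_pr co_p12 ds_uniq ds_div; have p_gt1 := prime_gt1 p_pr.
have gcd_gt0 : (0 < gcdn 12 p.-1)%N by rewrite gcdn_gt0.
have unit_ds i : exists t : {unit 'Z_p}, (t ^+ 12 = 1)%g /\ #[t]%g = tnth ds i.
  have [|t] := @units_Zp_exists_order p (tnth ds i) p_pr; last by exists t.
  by rewrite dvdn_divisors // -ds_div mem_tnth.
have [t tP] := fin_all_exists unit_ds.
have t12 i : (t i ^+ 12 = 1)%g by have [] := tP i.
have ord_t i : #[t i]%g = tnth ds i by have [] := tP i.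
have ds12 i : (tnth ds i %| 12)%N by rewrite -ord_t order_dvdn t12.
have ker i : has_kernel_of_order p (sdprod12 (t12 i)) (12 %/ tnth ds i).
  exists (brace12 : finLeftBraceType), (twist (t12 i)); split.
  - exact: card_brace12.
  - by rewrite card_ker_twist ord_t.
  - by exists id; split=> //; exists id.
exists (fun i => sdprod12 (t12 i)); split=> // [|i ord1].
  split=> [i|i j iso_ij|B BP].
  - split; first exact: sdprod12_add_isog.
    by exists (scaling (t12 i)); apply: sdprod12_mul_isog.
  - have := has_kernel_of_order_inj p_gt1 co_p12 (ker i).
    have [B' [tau [cardB' cardK iso_j]]] := ker j.
    move/(_ (12 %/ tnth ds j)%N) => eq_ker.
    apply/(tuple_uniqP _ ds_uniq)/(divn_dvd_inj _ (ds12 i) (ds12 j)) => //.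
    apply: eq_ker; exists B', tau; split=> //.
    exact: brace_iso_trans iso_ij iso_j.
  - have [u u12 uB] := has_groups_sdprod12 p_pr co_p12 BP.
    have : #[u]%g \in ds.
      rewrite ds_div -dvdn_divisors // dvdn_gcd order_dvdn u12 eqxx /=.
      rewrite -(totient_prime p_pr) -card_units_Zp ?prime_gt0 //.
      by rewrite order_dvdG ?inE.
    case/tnthP=> i ord_u; exists i.
    have [||||k co_k def_t] :=
      same_order_expg (units_Zp_cyclic p_pr) (t := u) (u := t i).
    + by rewrite inE.
    + by rewrite inE.
    + by rewrite ord_t.
    + by rewrite order_dvdn u12.
    exact: uB co_k def_t.
exists (brace12 : finLeftBraceType), (twist (t12 i)); split.
- exact: card_brace12.
- have t1 : t i = 1%g by apply/eqP; rewrite -order_eq1 ord_t ord1.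
  by move=> b; rewrite /= /dlog_expg t1 expg1n.
- by exists id; split=> //; exists id.
Qed.

Local Close Scope ring_scope.
Unset Implicit Arguments.

Theorem proposition12 (p : nat) (p_prime : prime p) (p_ge7 : 7 <= p) :
  [/\ p = 11 %[mod 12] ->
        exists Bs : 'I_2 -> finLeftBraceType,
        [/\ iso_representatives (has_groups_Zp62_ZpZ12 p) Bs,
            is_direct_product p (Bs ord0)
          & forall i : 'I_1,
              has_kernel_of_order p (Bs (lift ord0 i)) (tnth [tuple 6] i)],
      p = 5 %[mod 12] ->
        exists Bs : 'I_3 -> finLeftBraceType,
        [/\ iso_representatives (has_groups_Zp62_ZpZ12 p) Bs,
            is_direct_product p (Bs ord0)
          & forall i : 'I_2,
              has_kernel_of_order p (Bs (lift ord0 i)) (tnth [tuple 6; 3] i)],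
      p = 7 %[mod 12] ->
        exists Bs : 'I_4 -> finLeftBraceType,
        [/\ iso_representatives (has_groups_Zp62_ZpZ12 p) Bs,
            is_direct_product p (Bs ord0)
          & forall i : 'I_3,
              has_kernel_of_order p (Bs (lift ord0 i)) (tnth [tuple 6; 2; 4] i)]
    & p = 1 %[mod 12] ->
        exists Bs : 'I_6 -> finLeftBraceType,
        [/\ iso_representatives (has_groups_Zp62_ZpZ12 p) Bs,
            is_direct_product p (Bs ord0)
          & forall i : 'I_5,
              has_kernel_of_order p (Bs (lift ord0 i))
                (tnth [tuple 6; 4; 3; 2; 1] i)]].
Proof.
have co_p12 : coprime p 12.
  rewrite -[12]/(2 * 2 * 3) !coprimeMr !prime_coprime // !dvdn_prime2 //.
  by case: p p_ge7 {p_prime} => [|[|[|[|]]]].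
have gcd_mod r : p = r.+1 %[mod 12] -> gcdn 12 p.-1 = gcdn 12 r.
  move=> eq_pr; suff eq_mod : p.-1 = r %[mod 12].
    by rewrite -gcdn_modr eq_mod gcdn_modr.
  by apply/eqP; rewrite -(eqn_modDr 1) !addn1 prednK ?prime_gt0 //; apply/eqP.
(* The twists are listed by their orders d, so that 12 / d runs through the
   prescribed kernel orders, after d = 1 for the direct product. *)
split=> /gcd_mod gcdE.
- have [||||Bs [BsP dir ker]] := @classification p 2 [tuple 1; 2] => //.
    by move=> d; rewrite gcdE.
  exists Bs; split=> [||j]; [by [] | exact: dir | ].
  rewrite (_ : tnth _ j = 12 %/ tnth [tuple 1; 2] (lift ord0 j)) //.
  by case: j => [[|//] ?].
- have [||||Bs [BsP dir ker]] := @classification p 3 [tuple 1; 2; 4] => //.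
    by move=> d; rewrite gcdE.
  exists Bs; split=> [||j]; [by [] | exact: dir | ].
  rewrite (_ : tnth _ j = 12 %/ tnth [tuple 1; 2; 4] (lift ord0 j)) //.
  by case: j => [[|[|//]] ?].
- have [||||Bs [BsP dir ker]] := @classification p 4 [tuple 1; 2; 6; 3] => //.
    by move=> d; rewrite gcdE !inE [(d == 6) || _]orbC.
  exists Bs; split=> [||j]; [by [] | exact: dir | ].
  rewrite (_ : tnth _ j = 12 %/ tnth [tuple 1; 2; 6; 3] (lift ord0 j)) //.
  by case: j => [[|[|[|//]]] ?].
- have [||||Bs [BsP dir ker]] :=
    @classification p 6 [tuple 1; 2; 3; 4; 6; 12] => //.
    by move=> d; rewrite gcdE.
  exists Bs; split=> [||j]; [by [] | exact: dir | ].
  rewrite (_ : tnth _ j =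
               12 %/ tnth [tuple 1; 2; 3; 4; 6; 12] (lift ord0 j)) //.
  by case: j => [[|[|[|[|[|//]]]]] ?].
Qed.
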